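(* Let $G$ be a graph with $m$ edges and $t$ $6$-cycles, with maximum degree $\Delta(G)\le m^{2/5}$. Then the number of capped $3$-walks in $G$ is at most $\widetilde{O}(m^{1.6}+t)$.
   Context: Fix a total order $\succ$ on the vertices of $G$ such that $u\succ w$ whenever $\deg(u)>\deg(w)$ (ties broken arbitrarily). A $3$-walk is a walk $x_0,x_1,x_2,x_3$ with $3$ edges; it is capped if $x_0\succ x_i$ for $i=1,2,3$. $\widetilde{O}$ hides factors polylogarithmic in the number of vertices $n$ (with $m\ge n$). *)

(* Defs.v *)
From mathcomp Require Import all_boot all_order all_algebra.
From mathcomp Require Import reals exp.
Set Implicit Arguments.
Unset Strict Implicit.
Unset Printing Implicit Defensive.

Definition simple_graph (V : finType) (e : rel V) : Prop :=
  symmetric e /\ irreflexive e.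

Definition edges (V : finType) (e : rel V) : {set {set V}} :=
  [set [set p.1; p.2] | p : V * V & e p.1 p.2].

Definition deg (V : finType) (e : rel V) (x : V) : nat := #|[set y | e x y]|.

Definition max_deg (V : finType) (e : rel V) : nat := \max_(x : V) deg e x.

(* [gt u w] stands for u \succ w. *)
Definition strict_total_order (V : finType) (gt : rel V) : Prop :=
  [/\ irreflexive gt, transitive gt
    & forall u w : V, u != w -> gt u w || gt w u].

Definition degree_ordering (V : finType) (e gt : rel V) : Prop :=
  strict_total_order gt /\ forall u w : V, deg e w < deg e u -> gt u w.

(* For a duplicate-free [c], the edges of the closed walk through [c]. *)
Definition cycle_edges (V : finType) (c : seq V) : {set {set V}} :=
  [set [set x; next c x] | x in c].

(* A 6-cycle is counted as a subgraph, identified with its edge set, so the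
   12 rooted oriented traversals of one cycle are counted once. *)
Definition six_cycles (V : finType) (e : rel V) : {set {set {set V}}} :=
  [set cycle_edges c | c : 6.-tuple V & ucycleb e c].

Definition capped_3walks (V : finType) (e gt : rel V) : {set 4.-tuple V} :=
  [set x : 4.-tuple V | sorted e x && all (gt (thead x)) (behead x)].

(* Main.v *)
Require Import Defs.
From mathcomp Require Import all_boot all_order all_algebra.
From mathcomp Require Import reals exp.
From mathcomp Require Import ring lra.
Import Order.TTheory GRing.Theory Num.Theory.
Local Open Scope ring_scope.

(* Put [q = m^(1/5)] and let [S x] be the sum of [sqrt (deg y)] over the
   neighbours [y] of [x]. Since a cap [x0] has degree at least that of [x2], the
   capped 3-walks number at most the sum of [S x ^ 2] over the middle vertices
   [x = x1]. The vertices with [S x ^ 2 < q^3 deg x] contribute at most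
   [2 q^3 m = 2 q^8].

   Let [X] be the set of the other vertices, [W] the sum of [S x ^ 2] over [X],
   [E] the number of edges leaving [X] (so [q^3 E <= W]), and [H] (resp. [Q])
   the number of closed 6-walks (resp. 4-walks) whose odd vertices lie in [X].
   [W] is the value at the vector [sqrt (deg y)], of squared norm [2m], of a
   positive semidefinite form whose cube has trace [H], whence
   [W^3 <= (2m)^3 H]. A degenerate closed 6-walk has one of nine coincidences,
   each occurring in at most [D Q] walks with [D <= q^2] the maximum degree, and
   [Q^2 <= E H] by Cauchy-Schwarz. So either [H] is at most a constant times
   the number [t] of 6-cycles, and [W^3 = O(q^15 t)], or
   [H = O(D^2 E) = O(q W)], and [W^2 = O(q^16)]. Both give [W = O(q^8 + t)],
   with no logarithmic factor. *)

(** * Cauchy-Schwarz and a trace inequality *)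

Lemma sum_Cauchy_Schwarz (R : realDomainType) (I : finType) (a b : I -> R) :
  (\sum_i a i * b i) ^+ 2 <= (\sum_i a i ^+ 2) * (\sum_i b i ^+ 2).
Proof.
(* Lagrange's identity: the gap in the inequality is half a sum of squares. *)
have lagrange : \sum_i \sum_j (a i * b j - a j * b i) ^+ 2 =
    2 * ((\sum_i a i ^+ 2) * (\sum_i b i ^+ 2) - (\sum_i a i * b i) ^+ 2).
  transitivity (\sum_i \sum_j (a i ^+ 2 * b j ^+ 2 + a j ^+ 2 * b i ^+ 2
                  - 2 * ((a i * b i) * (a j * b j)))).
    by apply: eq_bigr => i _; apply: eq_bigr => j _; ring.
  under eq_bigr => i _ do rewrite sumrB big_split /= -mulr_sumr -mulr_suml
    -mulr_sumr -mulr_sumr.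
  rewrite sumrB big_split /= -mulr_suml -mulr_sumr -mulr_sumr -mulr_suml.
  by ring.
have : 0 <= \sum_i \sum_j (a i * b j - a j * b i) ^+ 2.
  by apply: sumr_ge0 => i _; apply: sumr_ge0 => j _; apply: sqr_ge0.
by rewrite lagrange pmulr_rge0 ?ltr0n // subr_ge0.
Qed.

Lemma sum_Cauchy_Schwarz_nat (I : finType) (a b : I -> nat) :
  ((\sum_i a i * b i) ^ 2 <= (\sum_i a i ^ 2) * (\sum_i b i ^ 2))%N.
Proof.
rewrite -(ler_nat int) natrX natrM !natr_sum.
rewrite (eq_bigr (fun i => (a i)%:R * (b i)%:R)) => [|i _]; last exact: natrM.
rewrite [X in _ <= X * _](eq_bigr (fun i => (a i)%:R ^+ 2)) => [|i _];
  last exact: natrX.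
rewrite [X in _ <= _ * X](eq_bigr (fun i => (b i)%:R ^+ 2)) => [|i _].
  exact: sum_Cauchy_Schwarz.
exact: natrX.
Qed.

(* [\sum_i S i ^+ 2] is the value of the quadratic form of [A^T A] at [w],
   and [\sum_i \sum_j p i j ^+ 2] is the trace of [(A^T A)^3]. *)
Lemma quadratic_form_trace_cube (R : realDomainType) (I J : finType)
    (A : I -> J -> R) (w : J -> R) (S : I -> R) (p : I -> J -> R) :
  (forall i, S i = \sum_j A i j * w j) ->
  (forall i j, p i j = \sum_j' \sum_i' A i j' * A i' j' * A i' j) ->
  (\sum_i S i ^+ 2) ^+ 3 <=
  (\sum_j w j ^+ 2) ^+ 3 * \sum_i \sum_j p i j ^+ 2.
Proof.
move=> defS defp.
set W := \sum_i S i ^+ 2; set n := \sum_j w j ^+ 2; set H := \sum_i _.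
(* In matrix terms [S = A w], [g = A^T S] and [h = A g = p w]. Cauchy-Schwarz bounds [W], the
   squared norm of [g] and that of [h] in turn; combined, the three bounds give the claim multiplied
   by [W]. *)
pose g j := \sum_i A i j * S i; pose h i := \sum_j A i j * g j.
have W0 : 0 <= W by apply: sumr_ge0 => i _; apply: sqr_ge0.
have n0 : 0 <= n by apply: sumr_ge0 => i _; apply: sqr_ge0.
have H0 : 0 <= H.
  by apply: sumr_ge0 => i _; apply: sumr_ge0 => j _; apply: sqr_ge0.
have defW : W = \sum_j w j * g j.
  under [RHS]eq_bigr do rewrite mulr_sumr.
  rewrite exchange_big /=; apply: eq_bigr => i _.
  rewrite expr2 {1}defS mulr_suml; apply: eq_bigr => j _; ring.
have le1 : W ^+ 2 <= n * \sum_j g j ^+ 2 by rewrite {1}defW sum_Cauchy_Schwarz.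
have defG : \sum_j g j ^+ 2 = \sum_i S i * h i.
  under [RHS]eq_bigr do rewrite mulr_sumr.
  rewrite exchange_big /=; apply: eq_bigr => j _.
  by rewrite expr2 {1}/g mulr_suml; apply: eq_bigr => i _; ring.
have le2 : (\sum_j g j ^+ 2) ^+ 2 <= W * \sum_i h i ^+ 2.
  by rewrite defG sum_Cauchy_Schwarz.
have le3 : \sum_i h i ^+ 2 <= n * H.
  rewrite /H mulr_sumr; apply: ler_sum => i _.
  suff -> : h i = \sum_j w j * p i j by rewrite sum_Cauchy_Schwarz.
  transitivity (\sum_j' \sum_i' \sum_j A i j' * A i' j' * A i' j * w j).
    apply: eq_bigr => j' _; rewrite /g mulr_sumr; apply: eq_bigr => i' _.
    by rewrite defS !mulr_sumr; apply: eq_bigr => j _; ring.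
  under [RHS]eq_bigr => j _ do rewrite defp mulr_sumr.
  rewrite [RHS]exchange_big /=; apply: eq_bigr => j' _.
  rewrite exchange_big /=; apply: eq_bigr => j _.
  by rewrite mulr_sumr; apply: eq_bigr => i' _; ring.
have le4 : W * W ^+ 3 <= W * (n ^+ 3 * H).
  have G0 : 0 <= \sum_j g j ^+ 2 by apply: sumr_ge0 => j _; apply: sqr_ge0.
  have -> : W * W ^+ 3 = (W ^+ 2) ^+ 2 by ring.
  apply: (@le_trans _ _ ((n * \sum_j g j ^+ 2) ^+ 2)).
    by rewrite lerXn2r // nnegrE ?sqr_ge0 ?mulr_ge0.
  rewrite exprMn; apply: (@le_trans _ _ (n ^+ 2 * (W * (n * H)))).
    rewrite ler_wpM2l ?sqr_ge0 //; apply: le_trans le2 _.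
    by rewrite ler_wpM2l.
  by rewrite le_eqVlt; apply/orP; left; apply/eqP; ring.
have [Wle0|Wgt0] := leP W 0; last by rewrite ler_pM2l in le4.
have -> : W = 0 by apply/eqP; rewrite eq_le Wle0.
by rewrite expr0n /= mulr_ge0 ?exprn_ge0.
Qed.

(** * Counting in finite sets *)

Lemma card_rel_pairs (T U : finType) (F : T -> U -> bool) :
  #|[set z : T * U | F z.1 z.2]| = (\sum_t #|[set u | F t u]|)%N.
Proof.
rewrite -sum1_card (eq_bigl (fun z : T * U => F z.1 z.2)); last first.
  by move=> z; rewrite inE.
rewrite -(pair_big_dep xpredT F (fun _ _ => 1%N)) /=.
by apply: eq_bigr => t _; rewrite -sum1_card; apply: eq_bigl => u; rewrite inE.
Qed.

Lemma card_rel_pairs2 (T U : finType) (F : T -> U -> bool) :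
  #|[set z : T * (U * U) | F z.1 z.2.1 && F z.1 z.2.2]| =
  (\sum_t #|[set u | F t u]| ^ 2)%N.
Proof.
rewrite (card_rel_pairs _ _ (fun t r => F t r.1 && F t r.2)).
apply: eq_bigr => t _; rewrite -[RHS]mulnn -cardsX.
by apply: eq_card => r; rewrite !inE.
Qed.

Lemma leq_card_inj_in {T U : finType} (f : T -> U) {D : {set T}} {E : {set U}} :
  {in D &, injective f} -> {in D, forall x, f x \in E} -> (#|D| <= #|E|)%N.
Proof.
move=> injf fDE; rewrite -(card_in_imset injf); apply: subset_leq_card.
by apply/subsetP => _ /imsetP[x Dx ->]; apply: fDE.
Qed.

Lemma leq_card_fibers (T U : finType) (f : T -> U) (D : {set T}) (K : nat) :
  (forall x, x \in D -> #|[set z in D | f z == f x]| <= K)%N ->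
  (#|D| <= K * #|f @: D|)%N.
Proof.
move=> fib; rewrite -sum1_card (partition_big_imset f) /= mulnC -sum_nat_const.
apply: leq_sum => _ /imsetP[x Dx ->]; apply: leq_trans (fib x Dx).
by rewrite -sum1_card; apply: eq_leq; apply: eq_bigl => z; rewrite inE.
Qed.

Lemma card_tuples_in (T : finType) (n : nat) (Z : {set T}) :
  (#|[set c : n.-tuple T | all (mem Z) c]| <= #|Z| ^ n)%N.
Proof.
rewrite -[n in (_ ^ n)%N]card_ord -(card_ffun_on _ (mem Z)).
rewrite -[X in (_ <= X)%N]cardsE.
apply: (leq_card_inj_in (fun c : n.-tuple T => [ffun i => tnth c i])).
  move=> c c' _ _ eqc; apply: eq_from_tnth => i.
  by have := congr1 (fun f : {ffun _ -> _} => f i) eqc; rewrite !ffunE.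
move=> c; rewrite !inE => /allP allc; apply/ffun_onP => i.
by rewrite ffunE; apply: allc; apply: mem_tnth.
Qed.

(** * Edges, cycles and their traversals *)

Lemma cover_cycle_edges (V : finType) (c : seq V) :
  cover (cycle_edges c) = [set x in c].
Proof.
apply/setP => x; rewrite inE; apply/bigcupP/idP => [[_ /imsetP[y yc ->]]|xc].
  by rewrite !inE => /orP[]/eqP-> //; rewrite mem_next.
by exists [set x; next c x]; [apply: imset_f | rewrite !inE eqxx].
Qed.

(** Tuples with the same edge set have the same vertices, namely the [cover] of that set, so each
    fibre lies among the [6 ^ 6] tuples over at most six vertices. This crude factor replaces the
    exact 12. *)
Lemma card_six_ucycles (V : finType) (e : rel V) :
  (#|[set c : 6.-tuple V | ucycleb e c]| <= 6 ^ 6 * #|six_cycles e|)%N.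
Proof.
have -> : six_cycles e =
    (fun c : 6.-tuple V => cycle_edges c) @: [set c : 6.-tuple V | ucycleb e c].
  apply/setP => E; apply/imsetP/imsetP => -[c cE ->]; exists c => //;
  by move: cE; rewrite !inE.
apply: leq_card_fibers => c _.
apply: (@leq_trans #|[set z : 6.-tuple V | all (mem [set x in c]) z]|).
  apply: subset_leq_card; apply/subsetP => z; rewrite !inE => /andP[_ /eqP eqE].
  apply/allP => x xz /=; rewrite -cover_cycle_edges -eqE cover_cycle_edges.
  by rewrite inE.
apply: leq_trans (card_tuples_in _ _ _) _; rewrite leq_exp2r // cardsE.
by apply: leq_trans (card_size _) _; rewrite size_tuple.
Qed.

(** Forgetting the orientation of an edge is at most two-to-one. *)
Lemma sum_deg_edges (V : finType) (e : rel V) :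
  (\sum_x deg e x <= 2 * #|edges e|)%N.
Proof.
rewrite /deg -(card_rel_pairs _ _ e) /edges.
apply: leq_card_fibers => -[x y] _ /=.
apply: (@leq_trans #|[set (x, y); (y, x)]|); last by rewrite cards2; case: eqP.
apply: subset_leq_card; apply/subsetP => -[u v]; rewrite !inE /=.
move=> /andP[_ /eqP/setP eqs].
have := eqs u; have := eqs v; have := eqs x; have := eqs y.
rewrite !inE !eqxx ?orbT !xpair_eqE /=.
rewrite (eq_sym x u) (eq_sym x v) (eq_sym y u) (eq_sym y v).
by case: (u == x); case: (u == y); case: (v == x); case: (v == y).
Qed.

(** * Closed walks of length four and six *)

(* In [a x y] the vertex [x] is on the odd side of a bipartite graph and [y] on
   the even side, so the 3-walk visits [t.1, r.1, r.2, t.2]. *)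
Definition walk3 (V : finType) (a : rel V) (t r : V * V) : bool :=
  [&& a t.1 r.1, a r.2 r.1 & a r.2 t.2].

(* Two 3-walks with the same ends glue to the closed walk
   [t.1, r.1, r.2, t.2, s.2, s.1], where [z = (t, (r, s))]. *)
Definition closed_walks6 (V : finType) (a : rel V) :
    {set (V * V) * ((V * V) * (V * V))} :=
  [set z | walk3 V a z.1 z.2.1 && walk3 V a z.1 z.2.2].

Definition walk6_vertices (V : finType) (z : (V * V) * ((V * V) * (V * V))) :
    6.-tuple V :=
  [tuple z.1.1; z.2.1.1; z.2.1.2; z.1.2; z.2.2.2; z.2.2.1].

(** The walk is [z.1.1, z.2.1, z.1.2, z.2.2]: [z.1] holds the odd vertices and [z.2] the even
    ones. *)
Definition closed_walks4 (V : finType) (a : rel V) :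
    {set (V * V) * (V * V)} :=
  [set z | [&& a z.1.1 z.2.1, a z.1.2 z.2.1, a z.1.1 z.2.2 & a z.1.2 z.2.2]].

Lemma card_closed_walks6 (V : finType) (a : rel V) :
  #|closed_walks6 V a| = (\sum_t #|[set r | walk3 V a t r]| ^ 2)%N.
Proof. exact: (card_rel_pairs2 _ _ (walk3 V a)). Qed.

Lemma card_closed_walks4 (V : finType) (a : rel V) :
  #|closed_walks4 V a| =
  (\sum_t #|[set y | a t.1 y && a t.2 y]| ^ 2)%N.
Proof.
rewrite -(card_rel_pairs2 _ _ (fun t y => a t.1 y && a t.2 y)).
by apply: eq_card => z; rewrite !inE -!andbA.
Qed.

(** Cutting a closed 4-walk at an edge leaves a 3-walk whose ends are related by [a]. The count is
    thus the inner product of the indicator of [a] with the 3-walk counts, and Cauchy-Schwarz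
    applies. *)
Lemma closed_walks4_sqr_le (V : finType) (a : rel V) :
  (#|closed_walks4 V a| ^ 2 <=
   #|[set t : V * V | a t.1 t.2]| * #|closed_walks6 V a|)%N.
Proof.
have -> : #|closed_walks4 V a| =
    (\sum_t (a t.1 t.2) * #|[set r | walk3 V a t r]|)%N.
  transitivity #|[set z : (V * V) * (V * V) |
                   a z.1.1 z.1.2 && walk3 V a z.1 z.2]|.
    (* This exchange of coordinates is its own inverse, so it serves both inequalities. *)
    pose f (z : (V * V) * (V * V)) := ((z.1.1, z.2.2), (z.2.1, z.1.2)).
    apply/eqP; rewrite eqn_leq; apply/andP; split;
      apply: (leq_card_inj_in f);
      try (by move=> [[? ?] [? ?]] [[? ?] [? ?]] _ _ [-> -> -> ->]);
      move=> [[x x'] [y y']]; rewrite !inE /walk3 /=;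
      by case/and4P=> -> -> -> ->.
  rewrite (card_rel_pairs _ _ (fun t r => a t.1 t.2 && walk3 V a t r)).
  apply: eq_bigr => t _; case: (a t.1 t.2); rewrite ?mul1n // mul0n.
  by apply: eq_card0 => r; rewrite inE.
apply: leq_trans (sum_Cauchy_Schwarz_nat _ _ _) _; rewrite card_closed_walks6.
rewrite leq_mul2r; apply/orP; right; apply: eq_leq.
rewrite -sum1_card [RHS]big_mkcond /=; apply: eq_bigr => t _.
by rewrite inE; case: (a t.1 t.2).
Qed.

(** When two vertices at distance two along a closed 6-walk coincide, what remains is a closed
    4-walk with a pendant edge, attached here at the vertex chosen by [f]. *)
Lemma card_pendant_closed_walks4 (V : finType) (a b : rel V) (D : nat)
    (f : (V * V) * (V * V) -> V) :
  (forall x, #|[set y | b x y]| <= D)%N ->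
  (#|[set z : ((V * V) * (V * V)) * V |
       (z.1 \in closed_walks4 V a) && b (f z.1) z.2]| <=
   D * #|closed_walks4 V a|)%N.
Proof.
move=> degb.
rewrite (card_rel_pairs _ _ (fun q y => (q \in closed_walks4 V a) && b (f q) y)).
rewrite mulnC -sum_nat_const [X in (_ <= X)%N]big_mkcond /=.
apply: leq_sum => q _; case: (q \in closed_walks4 V a) => //=.
by rewrite eq_card0 // => r; rewrite inE.
Qed.

(* The closed walks [x, y, x', x, x'', y'']: by Cauchy-Schwarz over the
   neighbours [x'] of [x], their number is at most the degree of [x] times the
   number of closed 4-walks whose first two odd vertices are [x, x']. *)
Lemma card_antipodal_walks6 (V : finType) (a : rel V) (D : nat) :
  (forall y, #|[set x | a x y]| <= D)%N ->
  (#|[set z in closed_walks6 V a | z.1.1 == z.1.2]| <=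
   D * #|closed_walks4 V a|)%N.
Proof.
move=> dega.
apply: (@leq_trans #|[set z : V * ((V * V) * (V * V)) |
          walk3 V a (z.1, z.1) z.2.1 && walk3 V a (z.1, z.1) z.2.2]|).
  apply: (leq_card_inj_in (fun z => (z.1.1, z.2))).
    move=> [[x u] p] [[x' u'] p']; rewrite !inE /=.
    by move=> /andP[_ /eqP->] /andP[_ /eqP->] [-> ->].
  by move=> [[x u] p]; rewrite !inE /= => /andP[H /eqP eqxu]; move: H; rewrite -eqxu.
rewrite (card_rel_pairs2 _ _ (fun x => walk3 V a (x, x))) card_closed_walks4.
rewrite -(pair_big xpredT xpredT
  (fun x x' => #|[set y | a x y && a x' y]| ^ 2)%N) /= big_distrr /=.
apply: leq_sum => x _.
have -> : #|[set r | walk3 V a (x, x) r]| =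
    (\sum_x' (a x' x) * #|[set y | a x y && a x' y]|)%N.
  transitivity #|[set r : V * V | a r.1 x && (a x r.2 && a r.1 r.2)]|.
    pose s (r : V * V) := (r.2, r.1).
    apply/eqP; rewrite eqn_leq; apply/andP; split;
      apply: (leq_card_inj_in s);
      try (by move=> [? ?] [? ?] _ _ [-> ->]);
      move=> [y x']; rewrite !inE /walk3 /=; by case/and3P=> -> -> ->.
  rewrite (card_rel_pairs _ _ (fun x' y => a x' x && (a x y && a x' y))).
  apply: eq_bigr => x' _; case: (a x' x); rewrite ?mul1n // mul0n.
  by apply: eq_card0 => r; rewrite inE.
apply: leq_trans (sum_Cauchy_Schwarz_nat _ _ _) _.
rewrite leq_mul2r; apply/orP; right; apply: leq_trans (dega x).
apply: eq_leq; rewrite -sum1_card [RHS]big_mkcond /=; apply: eq_bigr => t _.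
by rewrite inE; case: (a t x).
Qed.

(** The first branch proves injectivity, the coincidence restoring any vertex that the map drops;
    the second finds the edges of the image among those of the 6-walk. *)
Local Ltac solve_coincidence :=
  [> move=> [[? ?] [[? ?] [? ?]]] [[? ?] [[? ?] [? ?]]]; rewrite !inE /=;
     by move=> /andP[_ /eqP ?] /andP[_ /eqP ?] [*]; subst
  | move=> [[? ?] [[? ?] [? ?]]]; rewrite !inE /walk3 /=;
    move=> /andP[/andP[/and3P[? ? ?] /and3P[? ? ?]] /eqP ?]; subst;
    by repeat (apply/andP; split)].

(** Of the 15 pairs of positions, 6 are edges, whose ends differ by irreflexivity. The 6 pairs at
    distance two give pendant 4-walks, and the 3 antipodal pairs reduce to one by rotating an even
    number of places. *)
Lemma card_closed_walks6_le (V : finType) (a : rel V) (D : nat) :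
  irreflexive a ->
  (forall x, #|[set y | a x y]| <= D)%N ->
  (forall y, #|[set x | a x y]| <= D)%N ->
  (#|closed_walks6 V a| <=
   #|[set z in closed_walks6 V a | uniq (walk6_vertices V z)]| +
   9 * (D * #|closed_walks4 V a|))%N.
Proof.
move=> irr degr degc.
set Q := (D * _)%N; set N := [set z in _ | uniq _].
pose B P := [set z in closed_walks6 V a | P z].
(* As [a] goes from odd to even vertices, there are two versions: the pendant vertex is even in
   [pendant_r] and odd in [pendant_c]. *)
have pendant_r (P : pred _) (f : _ -> ((V * V) * (V * V)) * V)
    (h : (V * V) * (V * V) -> V) :
    {in B P &, injective f} ->
    {in B P, forall z, ((f z).1 \in closed_walks4 V a) && a (h (f z).1) (f z).2} ->
    (#|B P| <= Q)%N.
  move=> injf fB; apply: leq_trans (card_pendant_closed_walks4 V a a D h degr).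
  by apply: (leq_card_inj_in f injf) => z zB; rewrite inE fB.
have pendant_c (P : pred _) (f : _ -> ((V * V) * (V * V)) * V)
    (h : (V * V) * (V * V) -> V) :
    {in B P &, injective f} ->
    {in B P, forall z, ((f z).1 \in closed_walks4 V a) && a (f z).2 (h (f z).1)} ->
    (#|B P| <= Q)%N.
  move=> injf fB.
  apply: leq_trans (card_pendant_closed_walks4 V a (fun x y => a y x) D h degc).
  by apply: (leq_card_inj_in f injf) => z zB; rewrite inE fB.
have antipodal (P : pred _) (f : _ -> (V * V) * ((V * V) * (V * V))) :
    {in B P &, injective f} ->
    {in B P, forall z, (f z \in closed_walks6 V a) && ((f z).1.1 == (f z).1.2)} ->
    (#|B P| <= Q)%N.
  move=> injf fB; apply: leq_trans (card_antipodal_walks6 V a D degc).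
  by apply: (leq_card_inj_in f injf) => z zB; rewrite inE fB.
(* A closed walk with vertices [v1, ..., v6] is [((v1, v4), ((v2, v3), (v6, v5)))];
   [Bij] treats [vi = vj], the other six pairs being edges. *)
have B13 : (#|B (fun z => z.1.1 == z.2.1.2)| <= Q)%N.
  by apply: (pendant_r _ (fun z => (((z.1.1, z.2.2.2), (z.1.2, z.2.2.1)), z.2.1.1))
    (fun q => q.1.1)); solve_coincidence.
have B35 : (#|B (fun z => z.2.1.2 == z.2.2.2)| <= Q)%N.
  by apply: (pendant_r _ (fun z => (((z.1.1, z.2.1.2), (z.2.1.1, z.2.2.1)), z.1.2))
    (fun q => q.1.2)); solve_coincidence.
have B15 : (#|B (fun z => z.1.1 == z.2.2.2)| <= Q)%N.
  by apply: (pendant_r _ (fun z => (((z.1.1, z.2.1.2), (z.2.1.1, z.1.2)), z.2.2.1))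
    (fun q => q.1.1)); solve_coincidence.
have B24 : (#|B (fun z => z.2.1.1 == z.1.2)| <= Q)%N.
  by apply: (pendant_c _ (fun z => (((z.1.1, z.2.2.2), (z.2.1.1, z.2.2.1)), z.2.1.2))
    (fun q => q.2.1)); solve_coincidence.
have B46 : (#|B (fun z => z.1.2 == z.2.2.1)| <= Q)%N.
  by apply: (pendant_c _ (fun z => (((z.1.1, z.2.1.2), (z.2.1.1, z.1.2)), z.2.2.2))
    (fun q => q.2.2)); solve_coincidence.
have B26 : (#|B (fun z => z.2.1.1 == z.2.2.1)| <= Q)%N.
  by apply: (pendant_c _ (fun z => (((z.2.1.2, z.2.2.2), (z.2.1.1, z.1.2)), z.1.1))
    (fun q => q.2.1)); solve_coincidence.
have B14 : (#|B (fun z => z.1.1 == z.1.2)| <= Q)%N.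
  by apply: (antipodal _ 
    (fun z => ((z.1.1, z.1.2), ((z.2.1.1, z.2.1.2), (z.2.2.1, z.2.2.2))))); solve_coincidence.
have B36 : (#|B (fun z => z.2.1.2 == z.2.2.1)| <= Q)%N.
  by apply: (antipodal _ 
    (fun z => ((z.2.1.2, z.2.2.1), ((z.1.2, z.2.2.2), (z.2.1.1, z.1.1))))); solve_coincidence.
have B25 : (#|B (fun z => z.2.1.1 == z.2.2.2)| <= Q)%N.
  by apply: (antipodal _ 
    (fun z => ((z.2.2.2, z.2.1.1), ((z.2.2.1, z.1.1), (z.1.2, z.2.1.2))))); solve_coincidence.
set U := N :|: B (fun z => z.1.1 == z.2.1.2)
  :|: B (fun z => z.2.1.2 == z.2.2.2) :|: B (fun z => z.1.1 == z.2.2.2)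
  :|: B (fun z => z.2.1.1 == z.1.2) :|: B (fun z => z.1.2 == z.2.2.1)
  :|: B (fun z => z.2.1.1 == z.2.2.1) :|: B (fun z => z.1.1 == z.1.2)
  :|: B (fun z => z.2.1.2 == z.2.2.1) :|: B (fun z => z.2.1.1 == z.2.2.2).
have subU : closed_walks6 V a \subset U.
  apply/subsetP => -[[v1 v4] [[v2 v3] [v6 v5]]].
  rewrite !inE /= /walk3 /= => /andP[/and3P[h1 h2 h3] /and3P[h4 h5 h6]].
  have neq x y : a x y -> x != y.
    by move=> axy; apply/eqP => eqxy; rewrite eqxy irr in axy.
  rewrite h1 h2 h3 h4 h5 h6 /= !inE.
  rewrite (eq_sym v2 v3) (eq_sym v4 v5).
  rewrite (negPf (neq _ _ h1)) (negPf (neq _ _ h2)) (negPf (neq _ _ h3)).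
  rewrite (negPf (neq _ _ h4)) (negPf (neq _ _ h5)) (negPf (neq _ _ h6)) /=.
  by do 9?case: eqP => //=.
(* Each of the nine unions raises the coefficient of [Q] by one. *)
have addU (X Y : {set (V * V) * ((V * V) * (V * V))}) k :
    (#|X| <= #|N| + k * Q -> #|Y| <= Q -> #|X :|: Y| <= #|N| + k.+1 * Q)%N.
  by move=> leX leY; rewrite mulSnr addnA (leq_trans (leq_card_setU X Y)) ?leq_add.
apply: leq_trans (subset_leq_card subU) _.
by do 9![apply: (addU) => //]; rewrite mul0n addn0.
Qed.

Lemma card_uniq_closed_walks6 (V : finType) (e a : rel V) :
  symmetric e -> subrel a e ->
  (#|[set z in closed_walks6 V a | uniq (walk6_vertices V z)]| <=
   6 ^ 6 * #|six_cycles e|)%N.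
Proof.
move=> syme sub_ae; apply: leq_trans (card_six_ucycles V e).
apply: (leq_card_inj_in (walk6_vertices V)).
  move=> [[v1 v4] [[v2 v3] [v6 v5]]] [[w1 w4] [[w2 w3] [w6 w5]]] _ _.
  by move/(congr1 val) => /= [-> -> -> -> -> ->].
move=> [[v1 v4] [[v2 v3] [v6 v5]]]; rewrite !inE /walk3 /ucycleb /=.
move=> /andP[/andP[/and3P[h1 h2 h3] /and3P[h4 h5 h6]] ->].
rewrite andbT (syme v2) (syme v4) (syme v6).
by rewrite (sub_ae _ _ h1) (sub_ae _ _ h2) (sub_ae _ _ h3) (sub_ae _ _ h4)
  (sub_ae _ _ h5) (sub_ae _ _ h6).
Qed.

(** * Capped walks and sums of square roots of degrees *)

Definition sqrt_deg_sum (R : realType) (V : finType) (e : rel V) (x : V) : R :=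
  \sum_(y | e x y) Num.sqrt (deg e y)%:R.

(* A capped walk has [deg x2 <= deg x0], so its [deg x2] continuations are at
   most [sqrt (deg x0) * sqrt (deg x2)] in number. *)
Lemma card_capped_3walks_le (R : realType) (V : finType) (e gt : rel V) :
  symmetric e -> degree_ordering e gt ->
  #|capped_3walks e gt|%:R <= \sum_x sqrt_deg_sum R V e x ^+ 2.
Proof.
move=> syme [[irr trans _] degP].
have gt_deg u w : gt u w -> (deg e w <= deg e u)%N.
  by move=> guw; rewrite leqNgt; apply/negP => /degP /(trans _ _ _ guw); rewrite irr.
(* Here [t] is [(x1, (x0, x2))] and [y] is [x3]; the cap is weakened to the comparison of the
   degrees of [x0] and [x2]. *)
pose F (t : V * (V * V)) y :=
  [&& e t.1 t.2.1, e t.1 t.2.2, (deg e t.2.2 <= deg e t.2.1)%N & e t.2.2 y].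
have le1 : (#|capped_3walks e gt| <= \sum_t #|[set y | F t y]|)%N.
  rewrite -(card_rel_pairs _ _ F).
  pose g (z : (V * (V * V)) * V) := [tuple z.1.2.1; z.1.1; z.1.2.2; z.2].
  apply: leq_trans (leq_imset_card g _); apply: subset_leq_card.
  apply/subsetP => x; case/tupleP: x => x0 x; case/tupleP: x => x1 x.
  case/tupleP: x => x2 x; case/tupleP: x => x3 x; rewrite (tuple0 x) inE /thead.
  rewrite !(tnth_nth x0) /= !andbT => /andP[/and3P[e01 e12 e23] /and3P[_ g02 _]].
  apply/imsetP; exists ((x1, (x0, x2)), x3); last exact: val_inj.
  by rewrite inE /F /= syme e01 e12 e23 gt_deg.
apply: (@le_trans _ _ (\sum_t #|[set y | F t y]|)%N%:R); first by rewrite ler_nat.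
rewrite natr_sum -(pair_bigA _ (fun x t => #|[set y | F (x, t) y]|%:R)) /=.
apply: ler_sum => x _.
rewrite expr2 {1}/sqrt_deg_sum mulr_suml.
under [leRHS]eq_bigr => x0 _ do rewrite mulr_sumr.
rewrite -(pair_bigA _ (fun x0 x2 => #|[set y | F (x, (x0, x2)) y]|%:R)) /=.
rewrite [leRHS]big_mkcond; apply: ler_sum => x0 _ /=.
case: ifP => e0; last first.
  rewrite big1 // => x2 _; rewrite eq_card0 // => y.
  by rewrite inE /F /= e0.
rewrite [leRHS]big_mkcond; apply: ler_sum => x2 _ /=.
have cards_0 : #|[set _ : V | false]| = 0%N.
  by apply: eq_card0 => y; rewrite inE.
rewrite /F /= e0 /=; case: ifP => e2 /=; last by rewrite cards_0.
case: leqP => /= [le20|_]; last by rewrite cards_0 mulr_ge0 ?sqrtr_ge0.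
rewrite -/(deg e x2) -[leLHS]sqr_sqrtr ?ler0n // expr2.
by rewrite ler_wpM2r ?sqrtr_ge0 // ler_sqrt ?ler_nat ?ler0n.
Qed.

Lemma card_walk3 (R : realType) (V : finType) (a : rel V) (x u : V) :
  #|[set r | walk3 V a (x, u) r]|%:R =
  \sum_y \sum_x' (a x y)%:R * (a x' y)%:R * (a x' u)%:R :> R.
Proof.
rewrite -sum1_card natr_sum big_mkcond pair_big /=.
apply: eq_bigr => -[y x'] _; rewrite inE /walk3 /=.
by case: (a x y); case: (a x' y); case: (a x' u); rewrite /= ?mul1r ?mul0r ?mulr0.
Qed.

(** In [quadratic_form_trace_cube], take for [A] the adjacency matrix with the rows outside [X] set
    to zero. Then [A A^T A] counts 3-walks by their ends, and pairs of 3-walks with common ends are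
    closed 6-walks. *)
Lemma sum_sqrt_deg_cube_le (R : realType) (V : finType) (e : rel V)
    (X : {set V}) :
  (\sum_(x in X) sqrt_deg_sum R V e x ^+ 2) ^+ 3 <=
  (2 * #|edges e|%:R) ^+ 3 *
  #|closed_walks6 V (fun x y => (x \in X) && e x y)|%:R.
Proof.
pose a : rel V := fun x y => (x \in X) && e x y; rewrite -/a.
pose S x : R := if x \in X then sqrt_deg_sum R V e x else 0.
have defS x : S x = \sum_y (a x y)%:R * Num.sqrt (deg e y)%:R.
  rewrite /S /a /sqrt_deg_sum; case: (x \in X) => /=.
    by rewrite big_mkcond; apply: eq_bigr => y _; case: ifP; rewrite ?mul1r ?mul0r.
  by rewrite big1 // => y _; rewrite mul0r.
have := quadratic_form_trace_cube R V V _ _ S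
  (fun x u => #|[set r | walk3 V a (x, u) r]|%:R) defS (card_walk3 R V a).
have -> : \sum_x S x ^+ 2 = \sum_(x in X) sqrt_deg_sum R V e x ^+ 2.
  rewrite [RHS]big_mkcond; apply: eq_bigr => x _; rewrite /S.
  by case: ifP; rewrite ?expr0n.
move=> le1; apply: le_trans le1 _.
have -> : \sum_x \sum_u #|[set r | walk3 V a (x, u) r]|%:R ^+ 2 =
    #|closed_walks6 V a|%:R :> R.
  rewrite card_closed_walks6 natr_sum pair_big /=; apply: eq_bigr => -[x u] _.
  by rewrite natrX.
rewrite ler_wpM2r ?ler0n // lerXn2r ?nnegrE ?mulr_ge0 ?ler0n //.
  by apply: sumr_ge0 => y _; apply: sqr_ge0.
rewrite (eq_bigr (fun y => (deg e y)%:R)) => [|y _];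
  last by rewrite sqr_sqrtr ?ler0n.
by rewrite -natr_sum -natrM ler_nat sum_deg_edges.
Qed.

(** * Combining the estimates *)

(* Either at least half of the closed 6-walks are 6-cycles, or
   [H <= 324 * D ^+ 2 * E]. *)
Lemma capped_bound_arith (R : realType) (W H Q N E D q t : R) :
  1 <= q -> 0 <= W -> 0 <= H -> 0 <= Q -> 0 <= N -> 0 <= E -> 0 <= D -> 0 <= t ->
  D <= q ^+ 2 -> q ^+ 3 * E <= W -> W ^+ 3 <= (2 * q ^+ 5) ^+ 3 * H ->
  H <= N + 9 * (D * Q) -> Q ^+ 2 <= E * H -> N <= 6 ^+ 6 * t ->
  W <= 72 * (q ^+ 8 + t).
Proof.
move=> q1 W0 H0 Q0 N0 E0 D0 t0 Dq EW WH HN QE Nt.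
have q0 : 0 < q by apply: lt_le_trans q1.
have q80 : 0 <= q ^+ 8 by rewrite exprn_ge0 // ltW.
have rhs0 : 0 <= 72 * (q ^+ 8 + t) by rewrite mulr_ge0 // addr_ge0.
have [le2N|lt2N] := leP H (2 * N).
  suff : W ^+ 3 <= (72 * (q ^+ 8 + t)) ^+ 3 by rewrite ler_pXn2r // nnegrE.
  (* The constant 72 is chosen so that its cube absorbs the factor [6 ^ 6] bounding [N]. *)
  have -> : (72 * (q ^+ 8 + t)) ^+ 3 = 6 ^+ 6 * (2 * (q ^+ 8 + t)) ^+ 3.
    have -> : 72 = 6 ^+ 2 * 2 :> R by rewrite -natrX -natrM.
    by rewrite -mulrA exprMn -exprM.
  apply: (le_trans WH).
  have q15 : q ^+ 15 <= (q ^+ 8) ^+ 2 by rewrite -exprM; apply: ler_weXn2l.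
  have K0 : (0 : R) <= 6 ^+ 6 by rewrite exprn_ge0.
  (* With [6 ^ 6] and [q ^ 8] abstracted, [16 u^2 t] remains to be bounded by the term [24 u^2 t] of
     [8 (u + t)^3]. *)
  move: (6 ^+ 6) K0 Nt => K K0 Nt; move: (q ^+ 8) q15 q80 => u q15 u0.
  have -> : (2 * q ^+ 5) ^+ 3 = 8 * q ^+ 15 by ring.
  have le1 : 8 * q ^+ 15 * H <= 8 * u ^+ 2 * (2 * (K * t)).
    have qge0 := ltW q0; have leH : H <= 2 * (K * t) by lra.
    by rewrite ler_pM ?mulr_ge0 ?exprn_ge0 ?ler_wpM2l.
  apply: (le_trans le1).
  have u2t : 0 <= u ^+ 2 * t by rewrite mulr_ge0 ?exprn_ge0.
  have ut2 : 0 <= u * t ^+ 2 by rewrite mulr_ge0 ?exprn_ge0.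
  have u3 : 0 <= u ^+ 3 by rewrite exprn_ge0.
  have t3 : 0 <= t ^+ 3 by rewrite exprn_ge0.
  have -> : 8 * u ^+ 2 * (2 * (K * t)) = K * (16 * (u ^+ 2 * t)) by ring.
  have -> : (2 * (u + t)) ^+ 3 = 8 * (u ^+ 3 + 3 * (u ^+ 2 * t)
    + 3 * (u * t ^+ 2) + t ^+ 3) by ring.
  by rewrite ler_wpM2l //; lra.
have Hgt0 : 0 < H by apply: le_lt_trans lt2N; rewrite mulr_ge0.
have ltDQ : H <= 18 * (D * Q) by lra.
(* Squaring [H <= 18 D Q] brings in [Q^2 <= E H], and one factor [H] cancels. *)
have leHE : H <= 324 * (q ^+ 4 * E).
  rewrite -(ler_pM2r Hgt0).
  have : H ^+ 2 <= (18 * (D * Q)) ^+ 2 by rewrite lerXn2r // nnegrE ?mulr_ge0.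
  rewrite expr2 => /le_trans; apply.
  have -> : (18 * (D * Q)) ^+ 2 = 324 * (D ^+ 2 * Q ^+ 2) by ring.
  have -> : 324 * (q ^+ 4 * E) * H = 324 * ((q ^+ 2) ^+ 2 * (E * H)) by ring.
  by rewrite ler_wpM2l // ler_pM ?exprn_ge0 // lerXn2r // nnegrE exprn_ge0 // ltW.
have leHW : H <= 324 * (q * W).
  apply: (le_trans leHE); rewrite ler_wpM2l //.
  have -> : q ^+ 4 * E = q * (q ^+ 3 * E) by ring.
  by rewrite ler_wpM2l // ltW.
(* The constant 54 works because [8 * 324 = 81 * 32] while [54 ^ 2 = 81 * 36]. *)
have W3 : W * W ^+ 2 <= W * (54 * q ^+ 8) ^+ 2.
  rewrite -exprS; apply: (le_trans WH).
  apply: (@le_trans _ _ ((2 * q ^+ 5) ^+ 3 * (324 * (q * W)))).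
    by rewrite ler_wpM2l // exprn_ge0 // mulr_ge0 // exprn_ge0 // ltW.
  have -> : (2 * q ^+ 5) ^+ 3 * (324 * (q * W)) = 81 * (32 * (W * (q ^+ 8) ^+ 2)).
    by ring.
  have -> : W * (54 * q ^+ 8) ^+ 2 = 81 * (36 * (W * (q ^+ 8) ^+ 2)) by ring.
  have Wq0 : 0 <= W * (q ^+ 8) ^+ 2 by rewrite mulr_ge0 ?sqr_ge0.
  by lra.
have [W00|Wgt0] := leP W 0; first exact: le_trans W00 rhs0.
suff : W <= 54 * q ^+ 8 by lra.
rewrite ler_pM2l // in W3.
by rewrite -(@ler_pXn2r _ 2) // nnegrE mulr_ge0.
Qed.

Theorem lemma4p2 (R : realType) :
  exists (C : R) (k : nat), 0 < C /\
    forall (V : finType) (e gt : rel V),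
      simple_graph e ->
      degree_ordering e gt ->
      (#|V| <= #|edges e|)%N ->
      (max_deg e)%:R <= (#|edges e|%:R : R) `^ (2 / 5) ->
      #|capped_3walks e gt|%:R <=
        C * ln (#|V|%:R : R) ^+ k
          * ((#|edges e|%:R : R) `^ (8 / 5) + #|six_cycles e|%:R).
Proof.
(* 74 is 72 for the vertices in [X] plus 2 for the others; exponent 0 makes the logarithmic factor
   1. *)
exists 74, 0%N; split=> // V e gt [syme irre] ordP leVm leD.
rewrite expr0 mulr1.
(* Without edges there are no vertices, hence no walks; otherwise [m >= 1] ensures [q >= 1]. *)
have [m0|m_gt0] := posnP #|edges e|.
  have V0 : #|V| = 0%N by apply/eqP; rewrite -leqn0 -m0.
  rewrite eq_card0 ?mulr_ge0 ?addr_ge0 ?powR_ge0 // => x.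
  by have := max_card (pred1 (thead x)); rewrite V0 card1.
pose q : R := #|edges e|%:R `^ (1 / 5).
have q1 : 1 <= q.
  by rewrite /q -[leLHS](powRr0 #|edges e|%:R) ler_powR ?ler1n // divr_ge0.
have q0 : 0 <= q by apply: le_trans q1.
have powq n : (#|edges e|%:R : R) `^ (n%:R / 5) = q ^+ n.
  by rewrite -powR_mulrn // /q -powRrM; congr (_ `^ _); ring.
have mq : (#|edges e|%:R : R) = q ^+ 5.
  by rewrite -powq divff ?pnatr_eq0 // powRr1 ?ler0n.
rewrite (powq 2) in leD; rewrite (powq 8).
set S := sqrt_deg_sum R V e.
pose X := [set x | q ^+ 3 * (deg e x)%:R <= S x ^+ 2].
pose a : rel V := fun x y => (x \in X) && e x y.
have degD x : (deg e x <= max_deg e)%N by rewrite /max_deg (bigD1 x) //= leq_maxl.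
have leW : \sum_(x in X) S x ^+ 2 <= 72 * (q ^+ 8 + #|six_cycles e|%:R).
  apply: (capped_bound_arith R _ #|closed_walks6 V a|%:R
    #|closed_walks4 V a|%:R
    #|[set z in closed_walks6 V a | uniq (walk6_vertices V z)]|%:R
    #|[set t : V * V | a t.1 t.2]|%:R (max_deg e)%:R) => //.
  - by apply: sumr_ge0 => x _; apply: sqr_ge0.
  - rewrite (card_rel_pairs _ _ a) natr_sum mulr_sumr [leRHS]big_mkcond.
    apply: ler_sum => x _ /=; case: ifP => xX.
      rewrite inE in xX; apply: le_trans xX.
      rewrite ler_wpM2l ?exprn_ge0 // ler_nat; apply: subset_leq_card.
      by apply/subsetP => y; rewrite !inE => /andP[].
    by rewrite eq_card0 ?mulr0 // => y; rewrite inE /a xX.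
  - by rewrite -mq sum_sqrt_deg_cube_le.
  - rewrite -!natrM -natrD ler_nat; apply: card_closed_walks6_le => [x|x|y].
    + by rewrite /a irre andbF.
    + apply: leq_trans (degD x); apply: subset_leq_card; apply/subsetP => y.
      by rewrite !inE => /andP[].
    + apply: leq_trans (degD y); apply: subset_leq_card; apply/subsetP => x.
      by rewrite !inE syme => /andP[].
  - by rewrite -natrX -natrM ler_nat closed_walks4_sqr_le.
  - rewrite -natrX -natrM ler_nat; apply: card_uniq_closed_walks6 => // x y.
    by case/andP.
have leWC : \sum_(x | x \notin X) S x ^+ 2 <= 2 * q ^+ 8.
  apply: (@le_trans _ _ (\sum_x q ^+ 3 * (deg e x)%:R)).
    rewrite big_mkcond; apply: ler_sum => x _; case: ifP => [|_].
      by rewrite inE -ltNge => /ltW.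
    by rewrite mulr_ge0 ?exprn_ge0.
  rewrite -mulr_sumr -natr_sum.
  have -> : 2 * q ^+ 8 = q ^+ 3 * (2 * #|edges e|)%:R by rewrite natrM mq; ring.
  by rewrite ler_wpM2l ?exprn_ge0 // ler_nat sum_deg_edges.
apply: le_trans (card_capped_3walks_le R V e gt syme ordP) _.
rewrite (bigID (mem X)) /=; have t0 := ler0n R #|six_cycles e|.
by rewrite -/S; lra.
Qed.
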